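(* Let $V$ be a finite set with $v=|V|\ge1$ and let $1\le k\le v$. Every distribution from the $k$-interaction model $\mathcal{E}_{S_k}$ on $\{0,1\}^V$ can be approximated arbitrarily well by the visible marginals of a pairwise interaction model with $h=\sum_{j=3}^kD(v,j)$ hidden binary variables. Here $D(v,j)\le\frac{1+\log(v-j+1)}{v-j+1}\binom{v}{j}$ and $D(v,j)\le\binom{v-1}{j-1}$ for $0<j\le v$. In particular, every probability distribution on $\{0,1\}^V$ can be approximated arbitrarily well by the visible marginals of a pairwise interaction model with $h=2^{v-1}-(v-1)-1$ hidden binary variables, and also (for $v\ge3$) with any integer number $$h\ \ge\ \frac{2(\log(v-2)+1)}{v+1}\Big(2^v-(v+1)-1-\frac{(v+1)v}{4}\Big)+1$$ of hidden binary variables.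
   Context: $\log$ denotes the natural logarithm. $k$-interaction model: with $S_k=\{\Lambda\subseteq V:|\Lambda|\le k\}$, $\mathcal{E}_{S_k}$ is the set of probability distributions on $\{0,1\}^V$ of the form $p(x)=\frac{1}{Z}\exp\big(\sum_{\Lambda\in S_k}J_\Lambda\prod_{i\in\Lambda}x_i\big)$ with arbitrary $J_\Lambda\in\mathbb{R}$, where $Z$ is the normalizing constant. Pairwise interaction model with $h$ hidden binary variables: with $H$ a set of cardinality $h$, the model has visible variables $x\in\{0,1\}^V$, hidden variables $y\in\{0,1\}^H$, biases, arbitrary pairwise interactions among visible variables and between visible and hidden variables, and no interactions between hidden variables. Its visible marginals are exactly the distributions on $\{0,1\}^V$ of the form $p(x)=\frac1Z\exp(F(x))$ with $$F(x)=\sum_{i\in V}b_ix_i+\sum_{\{i,i'\}\subseteq V,\,i\ne i'}b_{ii'}x_ix_{i'}+\sum_{j\in H}\log\Big(1+\exp\Big(\sum_{i\in V}w_{ji}x_i+c_j\Big)\Big),$$ with arbitrary real parameters and $Z$ the normalizing constant. A distribution $p$ can be approximated arbitrarily well by distributions from a model $\mathcal{M}$ if for every $\epsilon>0$ there is $q\in\mathcal{M}$ with $\max_x|p(x)-q(x)|\le\epsilon$. A star tuple is a set of the form $\{B\cup\{j\}: j\in B'\}$ with $B,B'\subseteq V$ and $B\cap B'=\emptyset$. $D(v,j)$ is the smallest number of star tuples whose union contains $\binom{V}{j}=\{\Lambda\subseteq V:|\Lambda|=j\}$. Empty sums are $0$. *)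

(* Defs.v *)
From HB Require Import structures.
From mathcomp Require Import all_boot all_order all_algebra.
From mathcomp Require Import classical_sets reals sequences exp.

Set Implicit Arguments.
Unset Strict Implicit.
Unset Printing Implicit Defensive.

Import Order.TTheory GRing.Theory Num.Theory.

Local Open Scope classical_set_scope.
Local Open Scope ring_scope.

Section Models.
Variable R : realType.

Definition is_distr (T : finType) (p : T -> R) : Prop :=
  (forall x, 0 <= p x) /\ \sum_x p x = 1.

Definition gibbs (T : finType) (E : T -> R) : T -> R :=
  fun x => expR (E x) / \sum_y expR (E y).

Definition interaction_energy (V : finType) (k : nat) (J : {set V} -> R)
    (x : {ffun V -> bool}) : R :=
  \sum_(L : {set V} | (#|L| <= k)%N) J L * \prod_(i in L) (x i)%:R.

Definition interaction_model (V : finType) (k : nat) :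
    set ({ffun V -> bool} -> R) :=
  [set p | exists J : {set V} -> R, p = gibbs (interaction_energy k J)].

(* [bb] is indexed by unordered pairs, that is, by the two-element subsets
   of [V]. *)
Definition pairwise_energy (V H : finType) (b : V -> R) (bb : {set V} -> R)
    (w : H -> V -> R) (c : H -> R)
    (xy : {ffun V -> bool} * {ffun H -> bool}) : R :=
  \sum_(i : V) b i * (xy.1 i)%:R
  + \sum_(e : {set V} | #|e| == 2%N) bb e * \prod_(i in e) (xy.1 i)%:R
  + \sum_(j : H) \sum_(i : V) w j i * (xy.1 i)%:R * (xy.2 j)%:R
  + \sum_(j : H) c j * (xy.2 j)%:R.

Definition visible_marginal (V H : finType)
    (p : {ffun V -> bool} * {ffun H -> bool} -> R) : {ffun V -> bool} -> R :=
  fun x => \sum_(y : {ffun H -> bool}) p (x, y).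

(* Summing out [y] factorizes over [H], so these are exactly the p(x) =
   exp(F(x)) / Z with F(x) = sum_i b_i x_i + sum_(i, i') b_(i i') x_i x_i'
   + sum_j ln (1 + exp (sum_i w_ji x_i + c_j)). *)
Definition pairwise_hidden_model (V H : finType) :
    set ({ffun V -> bool} -> R) :=
  [set p | exists (b : V -> R) (bb : {set V} -> R)
                  (w : H -> V -> R) (c : H -> R),
     p = visible_marginal (gibbs (pairwise_energy b bb w c))].

Definition approximable (T : finType) (M : set (T -> R)) (p : T -> R) : Prop :=
  forall eps : R, 0 < eps ->
    exists2 q, M q & \big[Num.max/0]_(x : T) `|p x - q x| <= eps.

End Models.

Section StarTuples.
Variable V : finType.
Local Open Scope nat_scope.

Definition is_star_tuple (S : {set {set V}}) : bool :=
  [exists B : {set V}, exists B' : {set V},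
     [disjoint B & B'] && (S == [set (j |: B)%SET | j in B']%SET)].

Definition star_covering (j : nat) (F : {set {set {set V}}}) : bool :=
  [forall S in F, is_star_tuple S]
  && ([set L : {set V} | #|L| == j]%SET \subset finset.cover F).

Lemma all_stars_covering (j : nat) :
  0 < j -> star_covering j [set S | is_star_tuple S]%SET.
Proof.
move=> j0; apply/andP; split.
  by apply/forall_inP => S; rewrite inE.
apply/fintype.subsetP => L; rewrite inE => /eqP cL.
have /card_gt0P[i iL] : 0 < #|L| by rewrite cL.
apply/bigcupP; exists [set L]%SET; last exact: set11.
rewrite inE; apply/existsP; exists (L :\ i)%SET.
apply/existsP; exists [set i]%SET.
by rewrite disjoint_sym disjoints1 setD11 imset_set1 finset.setD1K //= eqxx.
Qed.

(* This is D(v, j) for v = #|V|, of which alone it depends. By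
   [all_stars_covering], the minimum is over a nonempty set when 0 < j. For
   j = 0 no star tuple contains the empty set, and the value is junk. *)
Definition star_cover_number (j : nat) : nat :=
  #|[arg min_(F < [set S | is_star_tuple S]%SET | star_covering j F) #|F|]|.

End StarTuples.

(* Main.v *)
Require Import Defs.
From HB Require Import structures.
From mathcomp Require Import all_boot all_order all_algebra.
From mathcomp Require Import classical_sets reals sequences exp.
From mathcomp Require Import zify ring lra.

Set Implicit Arguments.
Unset Strict Implicit.
Unset Printing Implicit Defensive.

Import Order.TTheory GRing.Theory Num.Theory.

Local Open Scope ring_scope.

(** Summing out the hidden variables of a pairwise model turns the energy into
    a quadratic polynomial in the visible variables plus one softplus term per
    hidden unit ([visible_marginalE]). Since Gibbs distributions depend
    continuously on the energy ([gibbs_perturb]), it is enough to show that an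
    interaction energy of order [k] is a uniform limit of such sums, with
    [sum_(3 <= j <= k) D(v, j)] units ([interaction_energy_limit]).

    The key is [softplus_star]. Softplus is close to 0 far to the left and close
    to the identity far to the right. Very large weights on a set [B], with a
    bias placed so that the argument is positive only if all of [B] is switched
    on, therefore make the unit equal, up to a small error, to the product of
    the monomial of [B] with an affine function of the remaining variables. So
    one unit produces arbitrary coefficients on all the sets of a star with
    centre [B], and besides these only a (very large) coefficient on [B]
    itself. A covering of the [j]-sets by stars thus removes all terms of order
    [j] at the cost of changing the terms of order [j - 1]. Proceeding from
    order [k] down to order 3 leaves a quadratic energy, which the visible
    interactions represent exactly, up to a constant.

    The bounds on [D(v, j)] are covering bounds. Stars centred at the
    [(j - 1)]-sets that avoid a fixed vertex suffice, and the greedy algorithm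
    gives the logarithmic bound ([greedy_cover]). Finally, every function on the
    cube is an interaction energy of full order ([energy_interactionE]), so
    every positive distribution, and in the limit every distribution, is covered
    by the case [k = v]; summing the bounds on [D(v, j)] over [j] gives the
    two explicit numbers of hidden units. *)

(** * Limits of sums of softplus units *)

Section SoftplusUnits.
Variables (R : realType) (V : finType).
Local Notation state := {ffun V -> bool}.
Implicit Types (J : {set V} -> R) (x : state) (B : {set V}).

Definition monomial B x : R := \prod_(i in B) (x i)%:R.

Definition softplus (t : R) : R := ln (1 + expR t).

(** The contribution of one hidden unit, with weights [u.1] and bias [u.2], to
    the visible log-density. *)
Definition activation (u : (V -> R) * R) x : R :=
  softplus (\sum_i u.1 i * (x i)%:R + u.2).

(** The interaction energy of order [k] is existentially chosen for each
    accuracy [eps]: it has to absorb terms of order at most [k] whose size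
    grows without bound as [eps] tends to 0, so they cannot be fixed in
    advance. *)
Definition limit_of_units (k n : nat) (f : state -> R) : Prop :=
  forall eps : R, 0 < eps -> exists s : seq ((V -> R) * R), exists J,
    size s = n /\
    forall x, `|f x - (interaction_energy k J x + \sum_(u <- s) activation u x)|
                <= eps.

Lemma softplus_le_expR t : 0 <= softplus t <= expR t.
Proof.
have e0 := expR_gt0 t; apply/andP; split; first by apply: ln_ge0; lra.
by apply: le_ln1Dx; lra.
Qed.

(** Together with the exponential bound, this says that softplus is
    exponentially close to the identity at large positive arguments and to 0
    at large negative ones. *)
Lemma softplusE t : softplus t = t + softplus (- t).
Proof.
have e0 := expR_gt0 t; have e0' := expR_gt0 (- t).
rewrite -{2}[t]expRK -lnM ?posrE ?expR_gt0 //; last lra.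
by rewrite mulrDr mulr1 -expRD subrr expR0 addrC.
Qed.

Lemma interaction_energyD k J J' x :
  interaction_energy k (fun L => J L + J' L) x
  = interaction_energy k J x + interaction_energy k J' x.
Proof.
rewrite /interaction_energy -big_split.
by apply: eq_bigr => L _; rewrite mulrDl.
Qed.

Lemma interaction_energyS k J x :
  interaction_energy k.+1 J x
  = interaction_energy k J x
    + \sum_(L : {set V} | #|L| == k.+1) J L * monomial L x.
Proof.
rewrite /interaction_energy (bigID (fun L : {set V} => (#|L| <= k)%N)) /=.
congr (_ + _); apply: eq_bigl => L; lia.
Qed.

Lemma interaction_energy0 J x : interaction_energy 0 J x = J finset.set0.
Proof.
rewrite /interaction_energy (big_pred1 (@finset.set0 V)); last first.
  by move=> L; rewrite leqn0 cards_eq0.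
by rewrite big_set0 mulr1.
Qed.

Lemma interaction_energy_widen k l J : (k <= l)%N ->
  exists J', forall x, interaction_energy k J x = interaction_energy l J' x.
Proof.
move=> kl; exists (fun L : {set V} => if (#|L| <= k)%N then J L else 0) => x.
rewrite /interaction_energy [RHS](bigID (fun L : {set V} => (#|L| <= k)%N)) /=.
rewrite [X in _ = _ + X]big1 => [|L /andP[_ /negbTE ->]]; last by rewrite mul0r.
rewrite addr0; apply: eq_big => [L|L ->] //.
by case: (leqP #|L| k) => Lk; rewrite ?andbF ?andbT // (leq_trans Lk kl).
Qed.

Lemma interaction_energy_monomial k B a :
  (#|B| <= k)%N -> exists J, forall x,
    interaction_energy k J x = a * monomial B x.
Proof.
move=> Bk; exists (fun L => if L == B then a else 0) => x.
rewrite /interaction_energy (bigD1 B) //= eqxx [X in _ + X]big1 ?addr0 //.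
by move=> L /andP[_ /negbTE ->]; rewrite mul0r.
Qed.

Lemma limit_of_units_energy k J : limit_of_units k 0 (interaction_energy k J).
Proof.
move=> eps eps0; exists [::], J; split => // x.
by rewrite big_nil addr0 subrr normr0 ltW.
Qed.

Lemma eq_limit_of_units k n f g :
  f =1 g -> limit_of_units k n f -> limit_of_units k n g.
Proof.
move=> fg Lf eps /Lf [s [J [ss H]]]; exists s, J; split => // x.
by rewrite -fg.
Qed.

Lemma limit_of_unitsD k m n f g :
  limit_of_units k m f -> limit_of_units k n g ->
  limit_of_units k (m + n) (fun x => f x + g x).
Proof.
move=> Lf Lg eps eps0; have e2 : 0 < eps / 2 by lra.
have [s [J [ss Hs]]] := Lf _ e2; have [t [K [st Ht]]] := Lg _ e2.
exists (s ++ t), (fun L => J L + K L); rewrite size_cat ss st; split => // x.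
rewrite interaction_energyD big_cat /=.
move: (Hs x) (Ht x); rewrite !ler_norml.
by set a := \sum_(_ <- s) _; set b := \sum_(_ <- t) _ => ? ?; lra.
Qed.

(** Terms of order [k.+1] can be traded for units: the approximation of the
    top-order part is chosen after its coefficients are known, so it does not
    matter that they depend on [eps]. *)
Lemma limit_of_units_lower k m n f :
  limit_of_units k.+1 n f ->
  (forall J, limit_of_units k m
     (fun x => \sum_(L : {set V} | #|L| == k.+1) J L * monomial L x)) ->
  limit_of_units k (n + m) f.
Proof.
move=> Lf Ltop eps eps0; have e2 : 0 < eps / 2 by lra.
have [s [J [ss Hs]]] := Lf _ e2; have [t [K [st Ht]]] := Ltop J _ e2.
exists (s ++ t), (fun L => J L + K L); rewrite size_cat ss st; split => // x.
rewrite interaction_energyD big_cat /=.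
move: (Hs x) (Ht x); rewrite interaction_energyS !ler_norml.
set a := \sum_(_ <- s) _; set b := \sum_(_ <- t) _; set c := \sum_(_ | _) _.
by move=> ? ?; lra.
Qed.

(** The zero unit contributes the constant [ln 2]; it serves as padding. *)
Lemma limit_of_units1 k : limit_of_units k 1 (fun=> 0).
Proof.
move=> eps eps0.
have [|J HJ] := @interaction_energy_monomial k finset.set0 (- ln 2) _.
  by rewrite cards0.
exists [:: (fun=> 0, 0)], J; split => // x.
rewrite big_seq1 HJ /activation /softplus /monomial big_set0 mulr1.
rewrite big1 => [|i _]; last by rewrite mul0r.
by rewrite addr0 expR0 (_ : 1 + 1 = 2) // addNr subrr normr0 ltW.
Qed.

Lemma limit_of_units_leq k m n f :
  (m <= n)%N -> limit_of_units k m f -> limit_of_units k n f.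
Proof.
move=> /subnKC <-; elim: (n - m)%N => [|d IH] Lf; first by rewrite addn0.
rewrite -[d.+1]addn1 addnA.
apply: eq_limit_of_units (limit_of_unitsD (IH Lf) (limit_of_units1 k)).
by move=> x; rewrite addr0.
Qed.

Lemma monomial_supportedE B x :
  monomial B x = if B \subset [set i | x i] then 1 else 0.
Proof.
rewrite /monomial; case: ifPn => [/fintype.subsetP sB|].
  by apply: big1 => i /sB; rewrite inE => ->.
case/subsetPn => i iB; rewrite inE => /negbTE xi.
by rewrite (bigD1 i) //= xi mul0r.
Qed.

(** One unit realizes a whole star. The weights on [B] and the bias are so
    large that the argument of softplus is far below 0 unless [x] is 1 on all
    of [B], and far above 0 otherwise. Hence softplus acts as the product of
    the indicator of [B] with an affine function whose slopes, the weights on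
    [B'], are free. The price is the uncontrolled offset [b], a term of order
    [#|B|] only. *)
Lemma softplus_star B B' (a : V -> R) (eps : R) :
  [disjoint B & B'] -> 0 < eps ->
  exists u, exists b : R, forall x,
    `|activation u x - monomial B x * (b + \sum_(i in B') a i * (x i)%:R)|
      <= eps.
Proof.
move=> dB eps0.
(* [C] bounds the influence of the weights on [B'], so the argument of softplus
   has absolute value at least [b - C], the inverse of [eps]. *)
pose C := \sum_(i in B') `|a i|.
pose b := C + eps^-1.
have C0 : 0 <= C by apply: sumr_ge0.
have ei0 : 0 < eps^-1 by rewrite invr_gt0.
have small : expR (- eps^-1) <= eps.
  rewrite expRN -[leRHS]invrK lef_pV2 ?posrE ?expR_gt0 //.
  by apply: le_trans (expR_ge1Dx _); lra.
exists (fun i => if i \in B then 2 * b else if i \in B' then a i else 0,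
        b - 2 * b * #|B|%:R), b => x.
pose s := \sum_(i in B') a i * (x i)%:R.
have sC : `|s| <= C.
  apply: le_trans (ler_norm_sum _ _ _) _; apply: ler_sum => i _.
  by rewrite normrM; case: (x i); rewrite ?normr1 ?normr0 ?mulr1 ?mulr0.
rewrite -/s /activation /=; set t := (X in softplus X).
have tE : t = 2 * b * ((\sum_(i in B) (x i)%:R) - #|B|%:R) + b + s.
  rewrite /t (bigID (mem B)) /= (eq_bigr (fun i => 2 * b * (x i)%:R)); last first.
    by move=> i ->.
  rewrite -mulr_sumr.
  have -> : \sum_(i | i \notin B)
      (if i \in B then 2 * b else if i \in B' then a i else 0) * (x i)%:R = s.
    rewrite /s big_mkcond [RHS]big_mkcond /=; apply: eq_bigr => i _.
    have /pred0P/(_ i)/= := dB.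
    by case: (i \in B); case: (i \in B') => //= _; rewrite mul0r.
  by ring.
move: sC; rewrite ler_norml => /andP[sC1 sC2].
rewrite monomial_supportedE; case: ifPn => [/fintype.subsetP sB|].
  have {}tE : t = b + s.
    rewrite tE (eq_bigr (fun=> 1)) ?sumr_const ?subrr ?mulr0 ?add0r //.
    by move=> i /sB; rewrite inE => ->.
  rewrite softplusE mul1r tE.
  have /andP[p0 p1] := softplus_le_expR (- (b + s)).
  rewrite [X in `|X|](_ : _ = softplus (- (b + s))); last by ring.
  rewrite ger0_norm //; apply: le_trans p1 (le_trans _ small).
  by rewrite ler_expR /b; lra.
case/subsetPn => i iB; rewrite inE => /negbTE xi.
(* One missing vertex of [B] already costs [2 * b]. *)
have {}tE : t <= - eps^-1.
  have : \sum_(i in B) ((x i)%:R : R) <= #|B|%:R - 1.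
    rewrite (bigD1 i) //= xi add0r.
    have := sumr_const (mem B) (1 : R); rewrite (bigD1 i iB) /= => <-.
    rewrite [leRHS]addrC addKr.
    by apply: ler_sum => j _; case: (x j).
  rewrite tE; set S := \sum_(_ in _) _ => HS.
  have : 2 * b * (S - #|B|%:R) <= 2 * b * (-1).
    by apply: ler_wpM2l; rewrite /b; lra.
  by rewrite /b; lra.
rewrite mul0r subr0.
have /andP[p0 p1] := softplus_le_expR t.
rewrite ger0_norm //; apply: le_trans p1 (le_trans _ small).
by rewrite ler_expR.
Qed.

Lemma star_injective B B' : [disjoint B & B'] ->
  {in B' &, injective (fun j => j |: B)%SET}.
Proof.
move=> dB i j iB jB /setP/(_ i); rewrite !inE eqxx /=.
by rewrite (disjointFl dB iB) orbF => /esym/eqP.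
Qed.

(** Only stars of [k.+1]-sets have anything to realize; for all others the sum
    is empty and the unit is wasted. *)
Lemma limit_of_units_star k (S : {set {set V}}) J : is_star_tuple S ->
  limit_of_units k 1
    (fun x => \sum_(L in S | #|L| == k.+1) J L * monomial L x).
Proof.
case/existsP => B /existsP[B' /andP[dB /eqP ->]].
have cstar i : i \in B' -> #|(i |: B)%SET| = #|B|.+1.
  by move=> iB; rewrite cardsU1 (disjointFl dB iB).
have [Bk|Bk] := eqVneq #|B| k; last first.
  apply: eq_limit_of_units (limit_of_units1 k) => x; rewrite big1 //.
  move=> _ /andP[/imsetP[i iB ->]]; rewrite cstar // eqSS => /eqP.
  by move/eqP; rewrite (negbTE Bk).
move=> eps eps0; pose a i := J (i |: B)%SET.
have [u [b ub]] := softplus_star a dB eps0.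
have [|K HK] := @interaction_energy_monomial k B (- b) _; first by rewrite Bk.
exists [:: u], K; split => // x; rewrite big_seq1 HK.
rewrite (_ : \sum_(_ in _ | _) _ = monomial B x * \sum_(i in B') a i * (x i)%:R).
  rewrite distrC; move: (ub x); congr (`|_| <= _).
  by rewrite mulrDr; ring.
rewrite (eq_bigl (mem [set (i |: B)%SET | i in B']%SET)); last first.
  move=> L; rewrite andbC; apply: andb_idl => /imsetP[i iB ->].
  by rewrite cstar // Bk.
rewrite big_imset /=; last exact: star_injective.
rewrite mulr_sumr; apply: eq_bigr => i iB.
rewrite /monomial big_setU1 ?(disjointFl dB iB) //= -/(a i); ring.
Qed.

(** Stars may overlap: each coefficient is assigned to the last star of the
    sequence that contains its set, by setting it to 0 for the others. *)
Lemma limit_of_units_stars k (s : seq {set {set V}}) J :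
  all (@is_star_tuple V) s ->
  limit_of_units k (size s)
    (fun x => \sum_(L | has (fun S : {set _} => L \in S) s && (#|L| == k.+1))
                J L * monomial L x).
Proof.
elim: s => [|S s IH] /=.
  move=> _; have [|K HK] := @interaction_energy_monomial k finset.set0 0 _.
    by rewrite cards0.
  apply: eq_limit_of_units (limit_of_units_energy k K) => x.
  by rewrite HK mul0r big_pred0_eq.
case/andP => Sstar /IH Ls.
pose J' L := if has (fun S : {set _} => L \in S) s then 0 else J L.
have := limit_of_unitsD (@limit_of_units_star k S J' Sstar) Ls.
apply: eq_limit_of_units => x.
rewrite [RHS](bigID (fun L => has (fun S : {set _} => L \in S) s)) /= addrC.
congr (_ + _); last first.
  by apply: eq_bigl => L; case: has; rewrite ?orbT ?andbT ?andbF.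
rewrite (bigID (fun L => has (fun S : {set _} => L \in S) s)) /= big1 ?add0r.
  apply: eq_big => [L|L /andP[_]]; last by rewrite /J' => /negbTE ->.
  by case: has; rewrite ?orbT ?orbF ?andbF.
by move=> L /andP[_]; rewrite /J' => ->; rewrite mul0r.
Qed.

Lemma star_covering_min j : (0 < j)%N ->
  exists2 F, @star_covering V j F & #|F| = star_cover_number V j.
Proof.
move=> j0; rewrite /star_cover_number.
by case: arg_minnP => [|F cF _]; [exact: all_stars_covering | exists F].
Qed.

(** A minimal star covering of the [k.+1]-sets provides one unit per star. *)
Lemma limit_of_units_top k J :
  limit_of_units k (star_cover_number V k.+1)
    (fun x => \sum_(L : {set V} | #|L| == k.+1) J L * monomial L x).
Proof.
have [F /andP[/forall_inP Fstar /fintype.subsetP Fcov] <-] :=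
  star_covering_min (ltn0Sn k).
rewrite cardE; apply: eq_limit_of_units (limit_of_units_stars _ _ _) => [x|].
  apply: eq_bigl => L; apply: andb_idl => cL.
  have /Fcov/bigcupP[S SF LS] : L \in [set L : {set V} | #|L| == k.+1]%SET.
    by rewrite inE.
  by apply/hasP; exists S; rewrite // mem_enum.
by apply/allP => S; rewrite mem_enum => /Fstar.
Qed.

(** Orders are removed from the top down: the units for order [j] disturb only
    the lower orders, which are treated later, and orders at most 2 are left to
    the visible pairwise interactions. *)
Lemma interaction_energy_limit k J :
  limit_of_units 2 (\sum_(3 <= j < k.+1) star_cover_number V j)
    (interaction_energy k J).
Proof.
have [k2|k2] := leqP k 2.
  rewrite big_geq //; have [K HK] := interaction_energy_widen J k2.
  by apply: eq_limit_of_units (limit_of_units_energy 2 K) => x.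
suff H f n : limit_of_units k n f ->
    limit_of_units 2 (n + \sum_(3 <= j < k.+1) star_cover_number V j) f.
  rewrite -[X in limit_of_units _ X]add0n; apply: H.
  exact: limit_of_units_energy.
elim: {J} k k2 n => // k IH; rewrite ltnS leq_eqVlt => /predU1P[<-|k2] n Lf.
  by rewrite big_nat1; apply: limit_of_units_lower Lf (limit_of_units_top _).
rewrite (big_nat_recr _ _ _ (leqW k2)) /= [X in (n + X)%N]addnC addnA.
apply: IH => //.
exact: limit_of_units_lower Lf (limit_of_units_top _).
Qed.

End SoftplusUnits.

(** * Covering by star tuples *)

(** The Lovasz-Stein bound for the greedy algorithm, with the harmonic sum
    replaced by the logarithm. The induction is on [d], a bound for the number
    of points of [U] in one set, and then on [#|U|]. If some set contains
    exactly [d] points of [U], choosing it lowers [#|U| / d] by 1. Otherwise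
    the bound [d] can be lowered by 1: double counting then gives
    [#|U| <= #|A| / r * (d - 1)], so that [#|U| / (d - 1) - #|U| / d] is at
    most [#|A| / r / d], hence at most [#|A| / r] times the decrease of the
    logarithm. *)
Lemma greedy_cover (R : realType) (T I : finType) (S : I -> {set T})
    (A : {set I}) (r d : nat) (U : {set T}) :
  (0 < r)%N -> (0 < d)%N ->
  (forall x, x \in U -> r <= #|[set i in A | x \in S i]%SET|)%N ->
  (forall i, i \in A -> #|S i :&: U| <= d)%N ->
  exists C : {set I}, [/\ C \subset A,
    (forall x, x \in U -> exists2 i, i \in C & x \in S i) &
    #|C|%:R <= #|U|%:R / d%:R + #|A|%:R / r%:R * ln d%:R :> R].
Proof.
move=> r0; elim: d U => // d IHd U _.
move: {2}#|U|.+1 (ltnSn #|U|) => n; elim: n U => // n IHn U Un Ur Ud.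
have r0R : 0 < r%:R :> R by rewrite ltr0n.
(* Incidences of points of [U] with sets of [A], counted in two ways. *)
have count e : (forall i, i \in A -> #|S i :&: U| <= e)%N ->
    #|U|%:R <= #|A|%:R / r%:R * e%:R :> R.
  move=> Ue; rewrite mulrAC ler_pdivlMr // -!natrM ler_nat.
  apply: (@leq_trans (\sum_(x in U) #|[set i in A | x \in S i]%SET|)).
    by rewrite -sum_nat_const; apply: leq_sum => x /Ur.
  rewrite (eq_bigr (fun x => \sum_(i in A | x \in S i) 1)%N); last first.
    by move=> x _; rewrite -sum1_card; apply: eq_bigl => i; rewrite !inE.
  rewrite (exchange_big_dep (mem A)) /=; last by move=> ? ? _ /andP[].
  rewrite -sum_nat_const; apply: leq_sum => i iA.
  apply: leq_trans (Ue i iA); rewrite -sum1_card.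
  by rewrite (eq_bigl (mem (S i :&: U))) // => x; rewrite !inE iA andbC.
have [/exists_inP[i iA /eqP ci]|] :=
    boolP [exists i in A, #|S i :&: U|%SET == d.+1].
  have cU : #|U :\: S i|%SET = (#|U| - d.+1)%N.
    by rewrite -ci -(cardsID (S i) U) finset.setIC addKn.
  have dU : (d.+1 <= #|U|)%N by rewrite -ci subset_leq_card ?finset.subsetIr.
  have [||| C [CA Ccov Cle]] := IHn (U :\: S i)%SET.
  - by rewrite cU; lia.
  - by move=> x /setDP[/Ur].
  - move=> j /Ud; apply: leq_trans; apply/subset_leq_card/finset.setIS.
    exact: finset.subsetDl.
  exists (i |: C)%SET; split.
  - by rewrite finset.subUset finset.sub1set iA.
  - move=> x xU; have [xi|xi] := boolP (x \in S i).
      by exists i; rewrite // setU11.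
    have [|j jC xj] := Ccov x; first by rewrite !inE xi.
    by exists j; rewrite // !inE jC orbT.
  - apply: (@le_trans _ _ (1 + #|C|%:R)).
      by rewrite nat1r ler_nat cardsU1; case: (_ \notin _).
    have -> : #|U|%:R / d.+1%:R = 1 + #|U :\: S i|%SET%:R / d.+1%:R :> R.
      by rewrite cU natrB // mulrBl divff ?pnatr_eq0 // addrC subrK.
    by rewrite -addrA lerD2l.
move=> /exists_inPn noS.
have {}Ud i : i \in A -> (#|S i :&: U| <= d)%N.
  by move=> iA; move: (Ud i iA) (noS i iA); rewrite leq_eqVlt => /orP[->|].
have Ule := count d Ud.
case: d IHd IHn Ud Ule noS => [|d] IHd IHn Ud Ule noS.
  have U0 : U = finset.set0.
    rewrite mulr0 in Ule.
    by apply/eqP; rewrite -finset.cards_eq0 -leqn0 -(ler_nat R).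
  exists finset.set0; split; rewrite ?finset.sub0set //.
    by move=> x; rewrite U0 inE.
  by rewrite U0 !cards0 ln1 mul0r mulr0 addr0.
have [C [CA Ccov Cle]] := IHd U isT Ur Ud.
exists C; split=> //; apply: le_trans Cle _.
set M := #|A|%:R / r%:R in Ule *.
have M0 : 0 <= M by apply: divr_ge0.
have d1 : 0 < d.+1%:R :> R by rewrite ltr0n.
have d2 : 0 < d.+2%:R :> R by rewrite ltr0n.
have dE : d.+2%:R = d.+1%:R + 1 :> R by rewrite natr1.
have lnd : ln d.+1%:R + d.+2%:R^-1 <= ln d.+2%:R :> R.
  rewrite addrC -lerBrDr -lerN2 opprB -ln_div ?posrE //.
  have -> : d.+1%:R / d.+2%:R = 1 + - d.+2%:R^-1 :> R.
    by rewrite dE; field; lra.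
  apply: le_ln1Dx; rewrite ltrN2 invf_lt1 // ltr1n //.
have step : #|U|%:R / d.+1%:R - #|U|%:R / d.+2%:R <= M / d.+2%:R.
  have -> : #|U|%:R / d.+1%:R - #|U|%:R / d.+2%:R
            = #|U|%:R / d.+1%:R / d.+2%:R :> R.
    by rewrite dE; field; apply/andP; split; lra.
  by rewrite ler_pM2r ?invr_gt0 // ler_pdivrMr.
have := ler_wpM2l M0 lnd; rewrite mulrDr; move: step.
move: (_ / d.+1%:R) (_ / d.+2%:R) (M / d.+2%:R).
move: (M * ln d.+1%:R) (M * ln d.+2%:R).
by move=> *; lra.
Qed.

Section StarCoverNumber.
Variable V : finType.
Implicit Types (B L : {set V}) (C : {set {set V}}).

Definition full_star B : {set {set V}} :=
  [set (i |: B)%SET | i in (~: B)%SET]%SET.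

Lemma full_star_is_star B : is_star_tuple (full_star B).
Proof.
apply/existsP; exists B; apply/existsP; exists (~: B)%SET.
by rewrite -setI_eq0 finset.setICr !eqxx.
Qed.

Lemma mem_full_star B i : i \notin B -> (i |: B)%SET \in full_star B.
Proof. by move=> iB; apply/imsetP; exists i; rewrite ?inE. Qed.

Lemma card_full_star B : (#|full_star B| <= #|V| - #|B|)%N.
Proof.
have -> : (#|V| - #|B|)%N = #|(~: B)%SET| by rewrite [RHS]cardsCs finset.setCK.
exact: leq_imset_card.
Qed.

(** Enlarging a star never hurts a covering, so the star with centre [B] may
    take every vertex outside [B] as a leaf; covering [j]-sets then means
    choosing centres such that every [j]-set contains one. *)
Lemma star_cover_number_le j C : (0 < j)%N ->
  (forall L, #|L| = j -> exists2 B, B \in C & L \in full_star B) ->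
  (star_cover_number V j <= #|C|)%N.
Proof.
move=> j0 Ccov; apply: (@leq_trans #|[set full_star B | B in C]%SET|); last first.
  exact: leq_imset_card.
rewrite /star_cover_number; case: arg_minnP => [|F _].
  exact: all_stars_covering.
apply; apply/andP; split.
  by apply/forall_inP => S /imsetP[B _ ->]; apply: full_star_is_star.
apply/fintype.subsetP => L; rewrite inE => /eqP/Ccov[B BC LB].
by apply/bigcupP; exists (full_star B); rewrite ?imset_f.
Qed.

(** The centres are the [(j - 1)]-sets avoiding a fixed vertex [v0]: from a
    [j]-set remove [v0] if it is there, and any element otherwise. *)
Lemma star_cover_number_le_bin j : (0 < j <= #|V|)%N ->
  (star_cover_number V j <= 'C(#|V| - 1, j - 1))%N.
Proof.
case/andP => j0 jv; have /card_gt0P[v0 _] : (0 < #|V|)%N by lia.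
have cW : (#|V| - 1)%N = #|(~: [set v0])%SET| by rewrite cardsC1 subn1.
rewrite cW -cards_draws; apply: star_cover_number_le => // L cL.
have [v1 [v1L BC]] : exists v1, v1 \in L /\ v0 \notin (L :\ v1)%SET.
  have [v0L|v0L] := boolP (v0 \in L); first by exists v0; rewrite setD11.
  have /card_gt0P[v1 v1L] : (0 < #|L|)%N by rewrite cL.
  by exists v1; rewrite !inE negb_and v0L orbT.
exists (L :\ v1)%SET; last first.
  by rewrite -{1}(finset.setD1K v1L) mem_full_star // setD11.
rewrite !inE finset.subsetC finset.sub1set inE BC /=.
by rewrite (cardsD1 v1 L) v1L in cL; rewrite -cL; apply/eqP; lia.
Qed.

Lemma bin_div_succ (R : realType) v j : (0 < j <= v)%N ->
  'C(v, j - 1)%:R / j%:R = 'C(v, j)%:R / (v - j + 1)%:R :> R.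
Proof.
case/andP => j0 jv; have := mul_bin_left v (j - 1).
have -> : (j - 1).+1 = j by lia.
have -> : (v - (j - 1) = v - j + 1)%N by lia.
move=> /(congr1 (fun n => n%:R : R)); rewrite !natrM => H.
apply/eqP; rewrite eqr_div ?pnatr_eq0; try lia.
by apply/eqP; rewrite mulrC [RHS]mulrC H.
Qed.

(** Greedy covering by the [(j - 1)]-sets: each [j]-set contains [j] of them,
    and each has at most [#|V| - j + 1] extensions. Both quotients in the greedy
    bound then are the same number. *)
Lemma star_cover_number_le_ln (R : realType) j : (0 < j <= #|V|)%N ->
  (star_cover_number V j)%:R
    <= (1 + ln (#|V| - j + 1)%:R) / (#|V| - j + 1)%:R * 'C(#|V|, j)%:R :> R.
Proof.
move=> jv; have /andP[j0 _] := jv; set d := (#|V| - j + 1)%N.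
have d0 : (0 < d)%N by rewrite /d; lia.
have [||C [CA Ccov Cle]] := @greedy_cover R _ _ full_star
  [set B : {set V} | #|B| == (j - 1)%N]%SET j d
  [set L : {set V} | #|L| == j]%SET j0 d0.
- move=> L; rewrite inE => /eqP cL; rewrite -{1}cL.
  have <- : #|[set (L :\ i)%SET | i in L]%SET| = #|L|.
    apply: card_in_imset => i k iL kL /setP/(_ i).
    by rewrite !inE eqxx iL /= andbT => /esym/negbFE/eqP.
  apply: subset_leq_card; apply/fintype.subsetP => _ /imsetP[i iL ->].
  rewrite !inE -{2}(finset.setD1K iL) mem_full_star ?setD11 // andbT.
  by rewrite (cardsD1 i L) iL in cL; rewrite -cL; apply/eqP; lia.
- move=> B; rewrite inE => /eqP cB.
  apply: leq_trans (subset_leq_card (finset.subsetIl _ _)) _.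
  by apply: leq_trans (card_full_star B) _; rewrite cB /d; lia.
apply: le_trans (_ : #|C|%:R <= _).
  rewrite ler_nat; apply: star_cover_number_le => // L cL.
  by apply: Ccov; rewrite inE cL.
apply: le_trans Cle _; rewrite !card_draws bin_div_succ // -/d.
by rewrite le_eqVlt; apply/orP; left; apply/eqP; ring.
Qed.

End StarCoverNumber.

Lemma sum_bin n : (\sum_(0 <= i < n.+1) 'C(n, i) = 2 ^ n)%N.
Proof.
rewrite -[2%N]/(1 + 1)%N expnDn big_mkord; apply: eq_bigr => i _.
by rewrite !exp1n !muln1.
Qed.

Lemma sum_bin_ge2 v : (0 < v)%N ->
  (\sum_(3 <= j < v.+1) 'C(v - 1, j - 1) = 2 ^ (v - 1) - (v - 1) - 1)%N.
Proof.
case: v => // v _; rewrite subn1 /= big_add1 /=.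
under eq_bigr do rewrite subn1 /=.
case: v => [|v]; first by rewrite big_geq.
rewrite -sum_bin [in RHS]big_ltn // [in RHS]big_ltn // bin0 bin1; lia.
Qed.

Lemma sum_bin_mid v : (3 <= v)%N ->
  (2 ^ v.+1
   = \sum_(3 <= j < v) 'C(v.+1, j) + 'C(v.+1, 2) + 2 * v.+1 + 2)%N.
Proof.
move=> v3; rewrite -sum_bin; do 3![rewrite big_ltn; last lia].
rewrite big_nat_recr /=; last lia.
rewrite big_nat_recr //= binn binSn bin0 bin1; lia.
Qed.

Lemma bin_div_down (R : realType) v j : (j <= v)%N ->
  'C(v, j)%:R / (v - j + 1)%:R = 'C(v.+1, j)%:R / v.+1%:R :> R.
Proof.
move=> jv; have := mul_bin_down v.+1 j.
have -> : (v.+1 - j = v - j + 1)%N by lia.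
move=> /(congr1 (fun n => n%:R : R)); rewrite !natrM /= => H.
apply/eqP; rewrite eqr_div ?pnatr_eq0; try lia.
by apply/eqP; rewrite mulrC H mulrC.
Qed.

(** For [j < v] the logarithm is at most [ln (v - 2)], and the quotient
    [bin(v, j) / (v - j + 1)] equals [bin(v + 1, j) / (v + 1)], so the sum over
    [j] is that of a row of Pascal's triangle short of a few terms at each end. The term
    [j = v] is a single star, which is the final summand 1. *)
Lemma sum_star_cover_number_le (R : realType) (V : finType) :
  let v := #|V| in (3 <= v)%N ->
  (\sum_(3 <= j < v.+1) star_cover_number V j)%:R
    <= 2 * (ln (v%:R - 2) + 1) / (v%:R + 1)
       * (2 ^+ v - (v%:R + 1) - 1 - (v%:R + 1) * v%:R / 4) + 1 :> R.
Proof.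
move=> v v3; have v0 : 0 < v%:R + 1 :> R by apply: ltr_wpDl.
set l := ln _.
pose S : R := (\sum_(3 <= j < v) 'C(v.+1, j))%:R.
have SE : S = 2 * (2 ^+ v - (v%:R + 1) - 1 - (v%:R + 1) * v%:R / 4).
  have := mul_bin_diag v.+1 1; rewrite /= bin1.
  move=> /(congr1 (fun n => n%:R : R)); rewrite !natrM -natr1 => H2.
  have : 2 ^+ v.+1 = S + 'C(v.+1, 2)%:R + 2 * (v%:R + 1) + 2 :> R.
    by rewrite natr1 -natrM -!natrD -natrX (sum_bin_mid v3).
  by rewrite exprS => H; lra.
have -> : 2 * (l + 1) / (v%:R + 1)
    * (2 ^+ v - (v%:R + 1) - 1 - (v%:R + 1) * v%:R / 4)
    = (1 + l) / (v%:R + 1) * S by rewrite SE; ring.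
rewrite big_nat_recr //= natrD; apply: lerD; last first.
  apply: le_trans (_ : ('C(v - 1, v - 1))%:R <= _); last by rewrite binn.
  by rewrite ler_nat star_cover_number_le_bin // leqnn andbT /v; lia.
rewrite /S !natr_sum mulr_sumr !big_nat; apply: ler_sum => j /andP[j3 jv].
have jv' : (0 < j <= #|V|)%N by rewrite -/v; lia.
apply: le_trans (star_cover_number_le_ln R jv') _; rewrite -/v.
rewrite mulrAC -mulrA bin_div_down; last lia.
rewrite natr1 mulrAC -mulrA; apply: ler_wpM2r; first by rewrite divr_ge0.
rewrite lerD2l /l -(natrB _ (_ : 2 <= v)%N); last lia.
rewrite ler_ln ?posrE ?ltr0n; try lia.
by rewrite ler_nat; lia.
Qed.

(** * Gibbs distributions *)

Section Gibbs.
Variables (R : realType) (T : finType).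
Implicit Types E : T -> R.

Lemma partition_gt0 E (x : T) : 0 < \sum_y expR (E y).
Proof.
rewrite (bigD1 x) //= ltr_wpDr ?expR_gt0 //.
by apply: sumr_ge0 => y _; apply: expR_ge0.
Qed.

Lemma gibbs_le1 E x : gibbs E x <= 1.
Proof.
rewrite /gibbs ler_pdivrMr ?partition_gt0 // mul1r (bigD1 x) //= lerDl.
by apply: sumr_ge0 => y _; apply: expR_ge0.
Qed.

Lemma gibbs_shift E E' c : (forall x, E' x = E x + c) -> gibbs E' =1 gibbs E.
Proof.
move=> EE' x; rewrite /gibbs EE' (eq_bigr (fun y => expR (E y) * expR c)).
  by rewrite -mulr_suml expRD -mulf_div divff ?mulr1 ?gt_eqF ?expR_gt0.
by move=> y _; rewrite EE' expRD.
Qed.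

(** A perturbation of the energy by [d] changes both the weight of [x] and the
    partition function by a factor of at most [expR d]. *)
Lemma gibbs_le_perturb E E' d : (forall x, `|E x - E' x| <= d) ->
  forall x, gibbs E x <= expR (2 * d) * gibbs E' x.
Proof.
move=> EE' x; have Z := partition_gt0 E x; have Z' := partition_gt0 E' x.
rewrite /gibbs ler_pdivrMr // mulrA mulrAC ler_pdivlMr //.
have HE y : expR (E y) <= expR d * expR (E' y).
  by rewrite -expRD ler_expR; have := EE' y; rewrite ler_norml; lra.
have HE' : \sum_y expR (E' y) <= expR d * \sum_y expR (E y).
  rewrite mulr_sumr; apply: ler_sum => y _; rewrite -expRD ler_expR.
  by have := EE' y; rewrite ler_norml; lra.
have -> : expR (2 * d) * expR (E' x) * \sum_y expR (E y)
   = (expR d * expR (E' x)) * (expR d * \sum_y expR (E y)).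
  by rewrite (_ : 2 * d = d + d) ?expRD; ring.
by apply: ler_pM => //; [exact: expR_ge0 | exact: ltW].
Qed.

Lemma gibbs_perturb E E' d : (forall x, `|E x - E' x| <= d) ->
  forall x, `|gibbs E x - gibbs E' x| <= expR (2 * d) - 1.
Proof.
move=> EE' x.
have d0 : 0 <= 2 * d by rewrite mulr_ge0 //; apply: le_trans (EE' x).
have e1 : 0 <= expR (2 * d) - 1.
  by have := expR_ge1Dx (2 * d); lra.
have E'E y : `|E' y - E y| <= d by rewrite distrC.
have := gibbs_le_perturb EE' x; have := gibbs_le_perturb E'E x.
have := ler_wpM2l e1 (gibbs_le1 E x); have := ler_wpM2l e1 (gibbs_le1 E' x).
rewrite !mulrBl !mul1r !mulr1 ler_norml => ? ? ? ?.
by apply/andP; split; lra.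
Qed.

Lemma gibbs_ln (q : T -> R) : (forall x, 0 < q x) -> \sum_x q x = 1 ->
  gibbs (fun x => ln (q x)) =1 q.
Proof.
move=> q0 q1 x; rewrite /gibbs (eq_bigr q) ?q1 ?divr1 ?lnK ?posrE //.
by move=> y _; rewrite lnK ?posrE.
Qed.

Lemma approximable_closed (M : set (T -> R)) p :
  (forall eps, 0 < eps -> exists2 q, approximable M q &
     forall x, `|p x - q x| <= eps) ->
  approximable M p.
Proof.
move=> Hp eps eps0; have e2 : 0 < eps / 2 by lra.
have [q /(_ _ e2)[r Mr qr] pq] := Hp _ e2; exists r => //.
apply: bigmax_le => [|x _]; first exact: ltW.
have := le_trans (le_bigmax 0 (fun x => `|q x - r x|) x) qr.
by move: (pq x); rewrite !ler_norml; lra.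
Qed.

End Gibbs.

(** * Pairwise models with hidden units *)

Section HiddenUnits.
Variables (R : realType) (V H : finType).
Local Notation state := {ffun V -> bool}.
Implicit Types (x : state).

Definition free_energy (b : V -> R) (bb : {set V} -> R) (w : H -> V -> R)
    (c : H -> R) x : R :=
  \sum_i b i * (x i)%:R + \sum_(e : {set V} | #|e| == 2%N) bb e * monomial R e x
  + \sum_j activation (w j, c j) x.

(** Hidden units do not interact, so for fixed [x] the weight is a product over
    the hidden units and the sum over [y] can be taken one unit at a time. *)
Lemma sum_hidden b bb w c x :
  \sum_(y : {ffun H -> bool}) expR (pairwise_energy b bb w c (x, y))
  = expR (free_energy b bb w c x).
Proof.
rewrite /free_energy expRD expR_sum.
pose t j := \sum_i w j i * (x i)%:R + c j.
have -> : \prod_j expR (activation (w j, c j) x)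
    = \prod_j \sum_(a : bool) expR (t j * a%:R).
  apply: eq_bigr => j _; rewrite lnK ?posrE ?addr_gt0 ?expR_gt0 //.
  by rewrite big_bool /= mulr1 mulr0 expR0 addrC.
rewrite bigA_distr_bigA /= mulr_sumr; apply: eq_bigr => y _.
rewrite -expR_sum -expRD /pairwise_energy /=; congr expR.
rewrite -!addrA; do 2![congr (_ + _)].
rewrite -big_split; apply: eq_bigr => j _ /=.
by rewrite mulrDl mulr_suml.
Qed.

Lemma visible_marginalE b bb w c :
  visible_marginal (gibbs (pairwise_energy b bb w c))
  =1 gibbs (free_energy b bb w c).
Proof.
move=> x; rewrite /visible_marginal /gibbs -mulr_suml sum_hidden.
congr (_ / _); rewrite (eq_bigr _ (fun x _ => esym (sum_hidden b bb w c x))).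
by rewrite pair_bigA; apply: eq_bigr => -[].
Qed.

(** The constant coefficient has no counterpart in the pairwise model; it is
    the only difference and normalization cancels it. *)
Lemma free_energy_units (J : {set V} -> R) (s : seq ((V -> R) * R)) :
  size s = #|H| -> exists b bb w c, forall x,
    free_energy b bb w c x
    = interaction_energy 2 J x + \sum_(u <- s) activation u x - J finset.set0.
Proof.
move=> sH; pose u j := nth (fun=> 0, 0) s (enum_rank (j : H)).
exists (fun i => J [set i]%SET), J, (fun j => (u j).1), (fun j => (u j).2) => x.
rewrite !interaction_energyS interaction_energy0 big_cards1 /free_energy.
have -> : \sum_(j : H) activation ((u j).1, (u j).2) x
   = \sum_(v <- s) activation v x.
  rewrite (big_nth (fun=> 0, 0)) big_mkord sH (reindex (@enum_rank H)) /=.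
    by apply: eq_bigr => j _; rewrite -surjective_pairing.
  exact/onW_bij/enum_rank_bij.
rewrite [X in _ = _ + X + _ + _ - _](_ : _ = \sum_i J [set i]%SET * (x i)%:R).
  by ring.
by apply: eq_bigr => i _; rewrite /monomial big_set1.
Qed.

Lemma limit_of_units_approximable n E :
  limit_of_units 2 n E -> (n <= #|H|)%N ->
  approximable (@pairwise_hidden_model R V H) (gibbs E).
Proof.
move=> LE nH eps eps0; have e1 : 0 < ln (1 + eps) / 2.
  by rewrite divr_gt0 // ln_gt0 //; lra.
have [s [J [sH HE]]] := limit_of_units_leq nH LE e1.
have [b [bb [w [c FE]]]] := free_energy_units J sH.
exists (visible_marginal (gibbs (pairwise_energy b bb w c))).
  by exists b, bb, w, c.
apply: bigmax_le => [|x _]; first exact: ltW.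
rewrite visible_marginalE (gibbs_shift FE).
apply: le_trans (gibbs_perturb HE x) _.
by rewrite mulrC divfK ?pnatr_eq0 // lnK ?posrE; lra.
Qed.

End HiddenUnits.

Section Distributions.
Variables (R : realType) (V H : finType).
Local Notation state := {ffun V -> bool}.

(** Moebius inversion over the subsets of [V]: the coefficient of [L] is fixed
    by the value at the indicator of [L] once the coefficients of the smaller
    sets are known. *)
Lemma energy_interactionE (E : state -> R) :
  exists J, forall x, interaction_energy #|V| J x = E x.
Proof.
(* The induction is on the size of the supports where the two sides agree. *)
suff [J HJ] : exists J, forall x : state,
    (#|[set i | x i]%SET| <= #|V|)%N -> interaction_energy #|V| J x = E x.
  by exists J => x; apply/HJ/max_card.
pose ind (L : {set V}) : state := [ffun i => i \in L].
have indK (x : state) : ind [set i | x i]%SET = x.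
  by apply/ffunP => i; rewrite ffunE inE.
elim: #|V| => [|k [J HJ]].
  exists (fun L => E (ind L)) => x; rewrite leqn0 finset.cards_eq0 => /eqP x0.
  by rewrite interaction_energy0 -x0 indK.
exists (fun L : {set V} => if #|L| == k.+1
         then E (ind L) - interaction_energy k J (ind L) else J L) => x.
rewrite interaction_energyS.
have -> : interaction_energy k (fun L : {set V} => if #|L| == k.+1
     then E (ind L) - interaction_energy k J (ind L) else J L) x
   = interaction_energy k J x.
  apply: eq_bigr => L Lk; case: eqP => // cL.
  by move: Lk; rewrite cL ltnn.
rewrite leq_eqVlt => /predU1P[xk|xk].
  rewrite (bigD1 [set i | x i]%SET) /=; last by rewrite xk.
  rewrite xk eqxx indK monomial_supportedE subxx mulr1 big1 ?addr0.
    by rewrite addrC subrK.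
  move=> L /andP[/eqP cL Lx]; rewrite cL eqxx monomial_supportedE.
  case: ifP => [Lsub|]; last by rewrite mulr0.
  by move: Lx; rewrite finset.eqEcard Lsub cL xk leqnn.
rewrite HJ // big1 ?addr0 // => L /eqP cL.
rewrite cL eqxx monomial_supportedE; case: ifP => [/subset_leq_card|]; last first.
  by rewrite mulr0.
by rewrite cL leqNgt xk.
Qed.

(** Mixing with the uniform distribution makes [p] positive, and a positive
    distribution is the Gibbs distribution of its logarithm, an interaction
    energy of order [#|V|]. *)
Lemma distr_approximable (p : state -> R) :
  (\sum_(3 <= j < #|V|.+1) star_cover_number V j <= #|H|)%N ->
  is_distr p -> approximable (pairwise_hidden_model H) p.
Proof.
move=> DH [p0 p1]; apply: approximable_closed => eps eps0.
pose d := Num.min eps 1; pose N : R := #|{: state}|%:R.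
have d0 : 0 < d by rewrite lt_min eps0 ltr01.
have d1 : d <= 1 by rewrite ge_min lexx orbT.
have N1 : 1 <= N.
  by rewrite ler1n; apply/card_gt0P; exists [ffun=> true].
have N0 : 0 < N by lra.
have iN0 : 0 < N^-1 by rewrite invr_gt0.
have iN1 : N^-1 <= 1 by rewrite invf_le1.
pose q x := (1 - d) * p x + d * N^-1.
have q0 x : 0 < q x.
  by rewrite ltr_wpDl ?mulr_gt0 // mulr_ge0 // subr_ge0.
have q1 : \sum_x q x = 1.
  rewrite big_split /= -mulr_sumr p1 sumr_const -mulr_natr -/N.
  by rewrite -mulrA mulVf ?gt_eqF //; ring.
have [J HJ] := energy_interactionE (fun x => ln (q x)).
exists (gibbs (interaction_energy #|V| J)).
  exact: limit_of_units_approximable (interaction_energy_limit _ _) DH.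
move=> x; have -> : gibbs (interaction_energy #|V| J) x = q x.
  rewrite -[RHS](gibbs_ln q0 q1); apply: (gibbs_shift (c := 0)) => y.
  by rewrite addr0.
have px1 : p x <= 1.
  by rewrite -p1 (bigD1 x) //= lerDl; apply: sumr_ge0.
have -> : p x - q x = d * (p x - N^-1) by rewrite /q; ring.
rewrite normrM gtr0_norm //; apply: (@le_trans _ _ (d * 1)).
  by apply: ler_wpM2l; [exact: ltW | rewrite ler_norml; have := p0 x; lra].
by rewrite mulr1 ge_min lexx.
Qed.

End Distributions.

Theorem corollary14 (R : realType) (V : finType) (v : nat)
    (cardV : #|V| = v) (v_ge1 : (1 <= v)%N) :
  [/\ forall k : nat, (1 <= k <= v)%N ->
        forall H : finType,
          #|H| = (\sum_(3 <= j < k.+1) star_cover_number V j)%N ->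
          forall p : {ffun V -> bool} -> R, interaction_model k p ->
            approximable (pairwise_hidden_model H) p,
      forall j : nat, (0 < j <= v)%N ->
        (star_cover_number V j)%:R
          <= (1 + ln (v - j + 1)%:R) / (v - j + 1)%:R * 'C(v, j)%:R :> R
        /\ (star_cover_number V j <= 'C(v - 1, j - 1))%N,
      forall H : finType, #|H| = (2 ^ (v - 1) - (v - 1) - 1)%N ->
        forall p : {ffun V -> bool} -> R, is_distr p ->
          approximable (pairwise_hidden_model H) p
    & (3 <= v)%N ->
        forall H : finType,
          2 * (ln (v%:R - 2) + 1) / (v%:R + 1)
            * (2 ^+ v - (v%:R + 1) - 1 - (v%:R + 1) * v%:R / 4) + 1
            <= #|H|%:R :> R ->
          forall p : {ffun V -> bool} -> R, is_distr p ->
            approximable (pairwise_hidden_model H) p].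
Proof.
split.
- move=> k _ H HD _ [J ->].
  apply: limit_of_units_approximable (interaction_energy_limit _ _) _.
  by rewrite HD.
- move=> j jv; rewrite -cardV in jv *; split.
    exact: star_cover_number_le_ln.
  exact: star_cover_number_le_bin.
- move=> H HE p; apply: distr_approximable; rewrite HE -sum_bin_ge2 // cardV.
  rewrite big_nat [leqRHS]big_nat; apply: leq_sum => j jv.
  by rewrite -cardV star_cover_number_le_bin // cardV; lia.
- move=> v3 H HE p; apply: distr_approximable.
  rewrite -(ler_nat R); apply: le_trans HE; rewrite -cardV.
  by apply: sum_star_cover_number_le; rewrite cardV.
Qed.
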